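(* Let the C*-algebras $A_n$, the maps $\Lambda_{m,n}$, the direct limit $A$ with canonical maps $\Lambda_{\infty,n}\colon A_n\to A$, and the actions $\alpha^{(n)}\colon\mathbb{Z}/2\mathbb{Z}\to\operatorname{Aut}(A_n)$ be as constructed in the context. Then $\alpha^{(n+1)}_1\circ\Lambda_{n+1,n} = \Lambda_{n+1,n}\circ\alpha^{(n)}_1$ for all $n\in\mathbb{Z}_{\ge 0}$. Moreover, there is a unique action $\alpha\colon\mathbb{Z}/2\mathbb{Z}\to\operatorname{Aut}(A)$ such that $\alpha = \varinjlim\alpha^{(n)}$ (that is, $\alpha_t\circ\Lambda_{\infty,n} = \Lambda_{\infty,n}\circ\alpha^{(n)}_t$ for all $t \in \mathbb{Z}/2\mathbb{Z}$ and all $n$), and this action has the Rokhlin property.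
   Context: Construction. For $n \in \mathbb{Z}_{\ge 0}$ set $d(n) = 2^{n+1}-1$, $l(n) = 2^{n+1}$, $r(0)=1$ and $r(n) = \prod_{k=1}^n 2^{k+1}$, $s(0)=1$ and $s(n) = \prod_{k=1}^n (2^{k+1}-1)$. Let $X_n = (S^2)^{s(n)}$, so that $X_{n+1} = X_n^{d(n+1)}$; for $\nu = 1,\dots,d(n+1)$ let $P^{(n)}_\nu \colon X_{n+1}\to X_n$ be the $\nu$-th coordinate projection. Choose points $x_m \in X_m$ for $m \in \mathbb{Z}_{\ge 0}$ such that for all $n \in \mathbb{Z}_{\geq 0}$ the set \[ \bigl\{ \bigl(P^{(n)}_{\nu_1}\circ P^{(n+1)}_{\nu_2}\circ\cdots\circ P^{(m-1)}_{\nu_{m-n}}\bigr)(x_m) : m = n, n+1, \dots,\ \nu_j = 1,\dots,d(n+j) \text{ for } j=1,\dots,m-n \bigr\} \] is dense in $X_n$ (for $m=n$ the contribution is $x_n$). Let $A_n = [C(X_n)\oplus C(X_n)]\otimes M_{r(n)}$. Define unital homomorphisms $\lambda_n \colon C(X_n)\oplus C(X_n) \to M_{l(n+1)}\bigl[C(X_{n+1})\oplus C(X_{n+1})\bigr]$ by \[ \lambda_n(f,g) = \Bigl(\operatorname{diag}\bigl(f\circ P^{(n)}_1,\dots,f\circ P^{(n)}_{d(n+1)}, g(x_n)\bigr),\ \operatorname{diag}\bigl(g\circ P^{(n)}_1,\dots,g\circ P^{(n)}_{d(n+1)}, f(x_n)\bigr)\Bigr), \] where $g(x_n), f(x_n)$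 are regarded as constant functions on $X_{n+1}$. Let $\Lambda_{n+1,n} = \lambda_n\otimes \operatorname{id}_{M_{r(n)}}\colon A_n\to A_{n+1}$ (identifying $M_{l(n+1)}\otimes M_{r(n)}$ with $M_{r(n+1)}$), and $\Lambda_{m,n} = \Lambda_{m,m-1}\circ\cdots\circ\Lambda_{n+1,n}$. Let $A = \varinjlim(A_n, (\Lambda_{m,n})_{m\ge n})$. Write $\mathbb{Z}/2\mathbb{Z} = \{0,1\}$ and let $\alpha^{(n)}\colon\mathbb{Z}/2\mathbb{Z}\to\operatorname{Aut}(A_n)$ be given by $\alpha^{(n)}_1((f,g)\otimes c) = (g,f)\otimes c$ for $f,g \in C(X_n)$, $c \in M_{r(n)}$. Rokhlin property (standard definition): an action $\alpha\colon G\to\operatorname{Aut}(A)$ of a finite group on a unital C*-algebra has the Rokhlin property if for every finite $F\subseteq A$ and $\varepsilon>0$ there are mutually orthogonal projections $e_g\in A$, $g\in G$, with $\|\alpha_g(e_h)-e_{gh}\|<\varepsilon$ for all $g,h \in G$, $\|e_g a - a e_g\|<\varepsilon$ for all $g\in G$, $a\in F$, and $\sum_{g\in G}e_g=1$. *)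

(* Defs.v *)
From HB Require Import structures.
From mathcomp Require Import all_boot all_order all_algebra all_fingroup.
From mathcomp Require Import spectral complex mxtens.
From mathcomp Require Import all_classical all_reals all_analysis.
Set Implicit Arguments.
Unset Strict Implicit.
Unset Printing Implicit Defensive.
Import Order.TTheory GRing.Theory Num.Theory.
Import numFieldNormedType.Exports.
Local Open Scope classical_set_scope.
Local Open Scope ring_scope.

(* [R[i]] seen through its [numClosedFieldType] structure, from which the
   topology and the norm of the complex numbers are inferred. *)
Definition cplx (R : realType) : numClosedFieldType := R[i].

(* Unital C*-algebras, the zero algebra included.  Following the library, the
   norm of a normed space over [cplx R] takes (nonnegative real) values in
   [cplx R]. *)
Record cstarAlg (R : realType) := CStarAlg {
  cs_space :> completeNormedModType (cplx R);
  cs_one : cs_space;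
  cs_mul : cs_space -> cs_space -> cs_space;
  cs_star : cs_space -> cs_space;
  cs_mulA : associative cs_mul;
  cs_mul1l : left_id cs_one cs_mul;
  cs_mul1r : right_id cs_one cs_mul;
  cs_mulDl : left_distributive cs_mul +%R;
  cs_mulDr : right_distributive cs_mul +%R;
  cs_mulZl : forall (c : cplx R) a b, cs_mul (c *: a) b = c *: cs_mul a b;
  cs_mulZr : forall (c : cplx R) a b, cs_mul a (c *: b) = c *: cs_mul a b;
  cs_starK : involutive cs_star;
  cs_starD : {morph cs_star : a b / a + b};
  cs_starZ : forall (c : cplx R) a, cs_star (c *: a) = c^* *: cs_star a;
  cs_starM : forall a b, cs_star (cs_mul a b) = cs_mul (cs_star b) (cs_star a);
  cs_normM : forall a b, `|cs_mul a b| <= `|a| * `|b|;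
  cs_norm_star : forall a, `|cs_mul (cs_star a) a| = `|a| ^+ 2
}.
Arguments cs_one {R}.
Arguments cs_mul {R _}.
Arguments cs_star {R _}.

Notation "a ** b" := (cs_mul a b) (at level 40, left associativity).

Definition RtoC (R : realType) (x : R) : cplx R := (x%:C)%C.

Definition is_unital_starhom (R : realType) (A B : cstarAlg R) (f : A -> B) : Prop :=
  [/\ linear f, forall a b, f (a ** b) = f a ** f b, f (cs_one A) = cs_one B
    & forall a, f (cs_star a) = cs_star (f a)].

Definition is_staraut (R : realType) (A : cstarAlg R) (f : A -> A) : Prop :=
  is_unital_starhom f /\ bijective f.

Definition is_cstar_action (R : realType) (A : cstarAlg R) (G : finGroupType)
    (alpha : G -> A -> A) : Prop :=
  [/\ forall g, is_staraut (alpha g), alpha 1%g = id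
    & forall g h, alpha (g * h)%g = alpha g \o alpha h].

Definition is_projection (R : realType) (A : cstarAlg R) (p : A) : Prop :=
  cs_star p = p /\ p ** p = p.

Definition rokhlin (R : realType) (A : cstarAlg R) (G : finGroupType)
    (alpha : G -> A -> A) : Prop :=
  forall (F : set A) (eps : R), finite_set F -> 0 < eps ->
  exists e : G -> A,
    [/\ forall g, is_projection (e g),
        forall g h, g != h -> e g ** e h = 0,
        forall g h, `|alpha g (e h) - e (g * h)%g| < RtoC eps,
        forall g a, F a -> `|e g ** a - a ** e g| < RtoC eps
      & \sum_(g : G) e g = cs_one A].

Section limit.
Context {R : realType} {A : nat -> cstarAlg R}.
Variable (L : forall n, A n -> A n.+1).

(* The composite A_n -> A_(k + n) of the maps of the sequence. *)
Fixpoint connecting_map k n : A n -> A (k + n) :=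
  if k is k'.+1 then fun a => L (connecting_map k' a) else id.

Definition is_cocone (B : cstarAlg R) (phi : forall n, A n -> B) : Prop :=
  (forall n, is_unital_starhom (phi n)) /\
  (forall k n (a : A n), phi (k + n)%N (connecting_map k a) = phi n a).

(* Direct limit in the category of unital C*-algebras and unital
   *-homomorphisms. *)
Definition is_direct_limit (B : cstarAlg R) (phi : forall n, A n -> B) : Prop :=
  is_cocone phi /\
  forall (D : cstarAlg R) (psi : forall n, A n -> D), is_cocone psi ->
    exists! h : B -> D, is_unital_starhom h /\ forall n a, h (phi n a) = psi n a.
End limit.

Section cont.
Context {R : realType} {X : topologicalType}.
Local Notation C := (cplx R).
Definition Cfun := continuousType X C.
HB.instance Definition _ := Choice.on Cfun.
Implicit Types f g h : Cfun.

Lemma CfunP f g : f =1 g -> f = g.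
Proof. by move=> fg; apply/continuousEP. Qed.

Lemma Cfun_cts f : continuous (f : X -> C).
Proof. exact: cts_fun. Qed.

Lemma Cfun0_cts : continuous (fun _ : X => 0 : C).
Proof. exact: cst_continuous. Qed.
Lemma Cfun1_cts : continuous (fun _ : X => 1 : C).
Proof. exact: cst_continuous. Qed.
Lemma CfunD_cts f g : continuous (fun x : X => f x + g x : C).
Proof. by move=> x; apply: cvgD; exact: Cfun_cts. Qed.
Lemma CfunN_cts f : continuous (fun x : X => - f x : C).
Proof. by move=> x; apply: cvgN; exact: Cfun_cts. Qed.
Lemma CfunM_cts f g : continuous (fun x : X => f x * g x : C).
Proof. by move=> x; apply: cvgM; exact: Cfun_cts. Qed.
Lemma conj_cts f : continuous (fun x : X => (f x)^* : C).
Proof.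
move=> x; apply/cvgrPdist_lt => e e0.
have /cvgrPdist_lt/(_ _ e0) := Cfun_cts (f := f) (x := x).
by apply: filterS => y; rewrite -rmorphB norm_conjC.
Qed.

Definition Cfun0 : Cfun := mkcts Cfun0_cts.
Definition Cfun1 : Cfun := mkcts Cfun1_cts.
Definition CfunD f g : Cfun := mkcts (@CfunD_cts f g).
Definition CfunN f : Cfun := mkcts (@CfunN_cts f).
Definition CfunM f g : Cfun := mkcts (@CfunM_cts f g).
Definition Cfunconj f : Cfun := mkcts (@conj_cts f).
Definition Cfuncst (z : C) : Cfun := mkcts (@cst_continuous X C z).

Lemma Cfuncomp_cts (Y : topologicalType) (p : Y -> X) (cp : continuous p) f :
  continuous (fun y : Y => f (p y) : C).
Proof. by move=> y; exact: (@continuous_comp _ _ _ p f y (cp y) (@Cfun_cts f (p y))). Qed.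
Fact Cfun_addA : associative CfunD.
Proof. by move=> f g h; apply: CfunP => x /=; exact: addrA. Qed.
Fact Cfun_addC : commutative CfunD.
Proof. by move=> f g; apply: CfunP => x /=; exact: addrC. Qed.
Fact Cfun_add0 : left_id Cfun0 CfunD.
Proof. by move=> f; apply: CfunP => x /=; exact: add0r. Qed.
Fact Cfun_addN : left_inverse Cfun0 CfunN CfunD.
Proof. by move=> f; apply: CfunP => x /=; exact: addNr. Qed.
HB.instance Definition _ := GRing.isZmodule.Build Cfun Cfun_addA Cfun_addC Cfun_add0 Cfun_addN.
Fact Cfun_mulA : associative CfunM.
Proof. by move=> f g h; apply: CfunP => x /=; exact: mulrA. Qed.
Fact Cfun_mulC : commutative CfunM.
Proof. by move=> f g; apply: CfunP => x /=; exact: mulrC. Qed.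
Fact Cfun_mul1 : left_id Cfun1 CfunM.
Proof. by move=> f; apply: CfunP => x /=; exact: mul1r. Qed.
Fact Cfun_mulDl : left_distributive CfunM +%R.
Proof. by move=> f g h; apply: CfunP => x /=; exact: mulrDl. Qed.
HB.instance Definition _ :=
  GRing.Zmodule_isComPzRing.Build Cfun Cfun_mulA Cfun_mulC Cfun_mul1 Cfun_mulDl.

Definition Cfunscale (z : C) f : Cfun := Cfuncst z * f.
Fact Cfun_scaleA a b f : Cfunscale a (Cfunscale b f) = Cfunscale (a * b) f.
Proof. by apply: CfunP => x /=; exact: mulrA. Qed.
Fact Cfun_scale1 : left_id 1 Cfunscale.
Proof. by move=> f; apply: CfunP => x /=; exact: mul1r. Qed.
Fact Cfun_scaleDr : right_distributive Cfunscale +%R.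
Proof. by move=> a f g; apply: CfunP => x /=; exact: mulrDr. Qed.
Fact Cfun_scaleDl f : {morph Cfunscale^~ f : a b / a + b}.
Proof. by move=> a b; apply: CfunP => x /=; exact: mulrDl. Qed.
HB.instance Definition _ := GRing.Zmodule_isLmodule.Build C Cfun
  Cfun_scaleA Cfun_scale1 Cfun_scaleDr Cfun_scaleDl.
End cont.
Arguments Cfun R X : clear implicits.
Definition Cfuncomp (R : realType) (X Y : topologicalType) (p : Y -> X)
  (f : Cfun R X) (cp : continuous p) : Cfun R Y := mkcts (@Cfuncomp_cts R X Y p cp f).

Section l2norm.
Context {R : realType} {r : nat}.
Local Notation C := (cplx R).
Implicit Types (u v : 'rV[C]_r) (M : 'M[C]_r).

Definition l2c v : C := sqrtC (dotmx v v).
Definition l2norm v : R := complex.Re (l2c v).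

Definition reC (z : C) : R := complex.Re z.

Lemma reK (z : C) : 0 <= z -> RtoC (reC z) = z.
Proof. by move=> z0; apply: RRe_real; exact: ger0_real. Qed.

Lemma RtoC_le (x y : R) : (RtoC x <= RtoC y) = (x <= y).
Proof. by rewrite /RtoC; exact: lecR. Qed.
Lemma RtoC_ge0 (x : R) : (0 <= RtoC x) = (0 <= x).
Proof. by have := RtoC_le 0 x. Qed.
Lemma RtoCD (x y : R) : RtoC (x + y) = RtoC x + RtoC y.
Proof. exact: (rmorphD (real_complex R)). Qed.

Lemma l2c_ge0 v : 0 <= l2c v.
Proof. by rewrite sqrtC_ge0 dnorm_ge0. Qed.

Lemma l2C v : RtoC (l2norm v) = l2c v.
Proof. by apply: reK; exact: l2c_ge0. Qed.

Lemma l2_ge0 v : 0 <= l2norm v.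
Proof. by rewrite -RtoC_ge0 l2C l2c_ge0. Qed.

Lemma l2cD u v : l2c (u + v) <= l2c u + l2c v.
Proof. by have [] := triangle_lerif (@dotmx C r) u v. Qed.

Lemma l2cZ (c : C) v : l2c (c *: v) = `|c| * l2c v.
Proof.
rewrite /l2c dnormZ sqrtCM ?nnegrE ?dnorm_ge0 ?exprn_ge0//.
by rewrite sqrCK.
Qed.

Lemma l2c_eq0 v : l2c v = 0 -> v = 0.
Proof. by move/eqP; rewrite sqrtC_eq0 dnorm_eq0 => /eqP. Qed.

Lemma l2c0 : l2c 0 = 0.
Proof. by rewrite -(scale0r 0) l2cZ normr0 mul0r. Qed.

Lemma l2cCS u v : `|dotmx u v| <= l2c u * l2c v.
Proof. by have [] := CauchySchwarz_sqrt (@dotmx C r) u v. Qed.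

Lemma l2c_sum (I : finType) (F : I -> 'rV[C]_r) : l2c (\sum_i F i) <= \sum_i l2c (F i).
Proof.
elim/big_rec2: _ => [|i x y _ h]; first by rewrite l2c0.
by apply: le_trans (l2cD _ _) _; rewrite lerD2l.
Qed.

Lemma dotE u v : dotmx u v = \sum_i u 0 i * (v 0 i)^*.
Proof. by rewrite dotmxE mxE; apply: eq_bigr => i _; rewrite !mxE. Qed.

Lemma l2c_entry v i : `|v 0 i| <= l2c v.
Proof.
rewrite -(@ler_sqr C) ?nnegrE ?l2c_ge0// sqrtCK dotE (bigD1 i)//= -normCK.
by rewrite lerDl sumr_ge0// => j _; rewrite -normCK exprn_ge0.
Qed.

Lemma l2c_delta i : l2c (delta_mx 0 i) = 1.
Proof.
rewrite /l2c dotE (bigD1 i)//= mxE !eqxx mul1r conjC1 big1 ?addr0 ?sqrtC1//.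
by move=> j /negPf ji; rewrite mxE eqxx ji mul0r.
Qed.

Definition entry_sum M : C := \sum_i \sum_j `|M i j|.

Lemma l2c_row i M : l2c (row i M) <= \sum_j `|M i j|.
Proof.
rewrite [row i M]row_sum_delta; apply: le_trans (l2c_sum _) _.
by apply: ler_sum => j _; rewrite l2cZ l2c_delta mulr1 mxE.
Qed.

Lemma l2c_mul v M : l2c (v *m M) <= l2c v * entry_sum M.
Proof.
rewrite mulmx_sum_row mulr_sumr; apply: le_trans (l2c_sum _) _.
apply: ler_sum => i _; rewrite l2cZ.
by apply: ler_pM => //; [exact: l2c_ge0 | exact: l2c_entry | exact: l2c_row].
Qed.

End l2norm.

Section real.
Context {R : realType}.
Local Notation C := (cplx R).
Lemma re_abs (z : C) : `|reC z| <= reC `|z|.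
Proof.
rewrite -RtoC_le (reK (normr_ge0 z)); have := normc_ge_Re z; by [].
Qed.
Lemma im_abs (z : C) : `|complex.Im z| <= reC `|z|.
Proof.
rewrite /reC normc_def -sqrtr_sqr /=; apply: (@ler_wsqrtr R).
by rewrite lerDr sqr_ge0.
Qed.

Lemma abs_ReIm (z : C) : `|z| <= RtoC (`|reC z| + `|complex.Im z|).
Proof.
rewrite normc_def -[X in X <= _]/(RtoC _) RtoC_le -[leRHS]ger0_norm ?addr_ge0// -[leRHS]sqrtr_sqr; apply: (@ler_wsqrtr R).
rewrite sqrrD !real_normK ?num_real// [leRHS]addrAC lerDl mulrn_wge0// mulr_ge0//.
Qed.
End real.

Section complete.
Context {R : realType}.
Local Notation C := (cplx R).

Lemma RtoC_gt0 (x : R) : (0 < RtoC x) = (0 < x).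
Proof. by rewrite /RtoC; exact: (@ltcR R 0 x). Qed.
Lemma re_lt (z : C) (e : R) : (`|z| < RtoC e) = (reC `|z| < e).
Proof. by rewrite -{1}(reK (normr_ge0 z)) /RtoC; exact: ltcR. Qed.
Lemma RtoC_re_gt0 (e : C) : 0 < e -> 0 < reC e /\ RtoC (reC e) = e.
Proof. by move=> e0; rewrite -RtoC_gt0 reK ?ltW. Qed.

Lemma cplx_complete (F : set_system C) : ProperFilter F -> cauchy F -> cvg F.
Proof.
move=> FF /cauchy_ballP Fc.
have aux (g : C -> R) : (forall a b, `|g a - g b| <= reC `|a - b|) -> cauchy (g @ F).
  move=> gL; apply/cauchy_ballP => e e0.
  have e0' : 0 < RtoC e by rewrite RtoC_gt0.
  rewrite near_map2.
  apply: filterS (Fc _ e0') => -[a b] /=.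
  rewrite -ball_normE /= re_lt => h.
  by rewrite -ball_normE /=; apply: le_lt_trans h; exact: gL.
have cRe : cvg (@reC R @ F).
  apply: R_complete; apply: aux => a b; apply: le_trans (re_abs _).
  by rewrite /reC raddfB.
have cIm : cvg ((@complex.Im R : C -> R) @ F).
  apply: R_complete; apply: aux => a b; apply: le_trans (im_abs _).
  by rewrite raddfB.
pose l : C := (lim (@reC R @ F) +i* lim ((@complex.Im R : C -> R) @ F))%C.
apply/cvg_ex; exists l.
apply/cvgrPdist_lt => e e0; have [re0 eE] := RtoC_re_gt0 e0.
have e20 : 0 < reC e / 2 by rewrite divr_gt0.
move/cvgrPdist_lt/(_ _ e20): cRe => h1.
move/cvgrPdist_lt/(_ _ e20): cIm => h2.
near=> z.
apply: le_lt_trans (abs_ReIm _) _.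
rewrite -eE /RtoC ltcR [ltRHS]splitr ltrD//.
  rewrite /reC raddfB; near: z; exact: h1.
rewrite raddfB; near: z; exact: h2.
Unshelve. all: end_near. Qed.

End complete.

Section bound.
Context {R : realType} {X : topologicalType}.
Hypothesis cX : compact [set: X].
Lemma Cfun_bound (f : Cfun R X) : exists M : R, forall x, `|f x| <= RtoC M.
Proof.
have cf : continuous (fun x => reC `|f x| : R).
  move=> x; apply/cvgrPdist_lt => e e0.
  have e0' : 0 < RtoC e by rewrite RtoC_gt0.
  have /cvgrPdist_lt/(_ _ e0') := Cfun_cts (f := f) (x := x).
  apply: filterS => y; rewrite re_lt => h.
  apply: le_lt_trans h.
  have := re_abs (`|f x| - `|f y|); rewrite /reC raddfB => h; apply: le_trans h _.
  rewrite -[leLHS]/(reC _) -[leRHS]/(reC _) -RtoC_le !reK//.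
  exact: ler_dist_dist.
have := continuous_compact (continuous_subspaceT cf) cX.
move=> /compact_bounded[M [_ hM]].
exists (M + 1) => x; rewrite -(reK (normr_ge0 (f x))) RtoC_le.
apply: le_trans (ler_norm _) _.
by apply: hM; [rewrite ltrDl | exists x].
Qed.
End bound.

(* M_r(C(X) (+) C(X)).  The compactness of X, which makes the norm finite, is a
   parameter so that the normed structure can be attached to this type. *)
Definition matCC (R : realType) (X : topologicalType) (cX : compact [set: X]) (r : nat) :=
  'M[Cfun R X * Cfun R X]_r.
HB.instance Definition _ (R : realType) (X : topologicalType) (cX : compact [set: X]) (r : nat) :=
  GRing.Zmodule.on (@matCC R X cX r).

Section matCC.
#[local] Opaque cplx.
Context {R : realType} {X : topologicalType} {cX : compact [set: X]} {r : nat}.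
Local Notation C := (cplx R).
Local Notation CC := (Cfun R X * Cfun R X)%type.
Local Notation M := (@matCC R X cX r).
Implicit Types (a b : M) (p : bool * X) (h : CC).

Definition mscale (z : C) (a : M) : M := map_mx (fun h => z *: h) a.
Fact mscaleA z w a : mscale z (mscale w a) = mscale (z * w) a.
Proof. by apply/matrixP => i j; rewrite !mxE scalerA. Qed.
Fact mscale1 : left_id 1 mscale.
Proof. by move=> a; apply/matrixP => i j; rewrite !mxE scale1r. Qed.
Fact mscaleDr : right_distributive mscale +%R.
Proof. by move=> z a b; apply/matrixP => i j; rewrite !mxE scalerDr. Qed.
Fact mscaleDl a : {morph mscale^~ a : z w / z + w}.
Proof. by move=> z w; apply/matrixP => i j; rewrite !mxE scalerDl. Qed.
HB.instance Definition _ := GRing.Zmodule_isLmodule.Build C M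
  mscaleA mscale1 mscaleDr mscaleDl.

Definition CCconj h : CC := (Cfunconj h.1, Cfunconj h.2).
Definition mstar (a : M) : M := (map_mx CCconj a)^T.

(* Evaluation at a point of the disjoint union of two copies of X. *)
Definition CCev (p : bool * X) (h : CC) : C := (if p.1 then h.1 else h.2) p.2.
Definition mev p (a : M) : 'M[C]_r := map_mx (CCev p) a.

Lemma CCevP h h' : (forall p, CCev p h = CCev p h') -> h = h'.
Proof.
case: h h' => [f g] [f' g'] E; congr (_, _); apply: CfunP => x.
  exact: (E (true, x)).
exact: (E (false, x)).
Qed.
Lemma CCevD p h h' : CCev p (h + h') = CCev p h + CCev p h'.
Proof. by case: p => -[] x. Qed.
Lemma CCevN p h : CCev p (- h) = - CCev p h.
Proof. by case: p => -[] x. Qed.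
Lemma CCevM p h h' : CCev p (h * h') = CCev p h * CCev p h'.
Proof. by case: p => -[] x. Qed.
Lemma CCevZ p z h : CCev p (z *: h) = z * CCev p h.
Proof. by case: p => -[] x. Qed.
Lemma CCev0 p : CCev p 0 = 0.
Proof. by case: p => -[] x. Qed.
Lemma CCev_conj p h : CCev p (CCconj h) = (CCev p h)^*%R.
Proof. by case: p => -[] x. Qed.

Lemma mevP a b : (forall p, mev p a = mev p b) -> a = b.
Proof.
move=> E; apply/matrixP => i j; apply: CCevP => p.
by have /matrixP/(_ i j) := E p; rewrite !mxE.
Qed.
Lemma mevD p a b : mev p (a + b) = mev p a + mev p b.
Proof. by apply/matrixP => i j; rewrite !mxE CCevD. Qed.
Lemma mevN p a : mev p (- a) = - mev p a.
Proof. by apply/matrixP => i j; rewrite !mxE CCevN. Qed.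
Lemma mevB p a b : mev p (a - b) = mev p a - mev p b.
Proof. by rewrite mevD mevN. Qed.
Lemma mev0 p : mev p 0 = 0.
Proof. by apply/matrixP => i j; rewrite !mxE CCev0. Qed.
Lemma mevM p a b : mev p (a *m b : M) = mev p a *m mev p b.
Proof.
apply/matrixP => i j; rewrite !mxE.
rewrite (big_morph (CCev p) (CCevD p) (CCev0 p)); apply: eq_bigr => k _.
by rewrite !mxE CCevM.
Qed.
Lemma mevZ p (z : C) a : mev p (z *: a) = z *: mev p a.
Proof. by apply/matrixP => i j; rewrite !mxE CCevZ. Qed.
Lemma mev_star p a : mev p (mstar a) = (map_mx Num.conj (mev p a))^T.
Proof. by apply/matrixP => i j; rewrite !mxE CCev_conj. Qed.

(* The C*-norm: the supremum over the two summands and the points of X of the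
   operator norm of a(x).  Here a(x) acts on row vectors from the right, which
   gives the same norm as its action on columns, as transposition is isometric
   on complex matrices. *)
Definition unit_ball_values a : set R :=
  [set t | exists p v, l2norm v <= 1 /\ t = l2norm (v *m mev p a)].
Definition mnormR a : R := sup (unit_ball_values a).
Definition mnorm a : C := RtoC (mnormR a).

Lemma mset_ub a : has_ubound (unit_ball_values a).
Proof.
have /choice[B HB] : forall ij : 'I_r * 'I_r, exists B : R,
    forall p, `|CCev p (a ij.1 ij.2)| <= RtoC B.
  move=> [i j]; have [B1 H1] := Cfun_bound cX (a i j).1.
  have [B2 H2] := Cfun_bound cX (a i j).2.
  exists (Order.max B1 B2) => -[[] x] /=.
    by apply: le_trans (H1 x) _; rewrite RtoC_le le_max lexx.
  by apply: le_trans (H2 x) _; rewrite RtoC_le le_max lexx orbT.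
exists (\sum_i \sum_j B (i, j)) => _ [p [v [v1 ->]]].
rewrite -RtoC_le l2C; apply: le_trans (l2c_mul _ _) _.
apply: le_trans (_ : entry_sum (mev p a) <= _).
  rewrite ler_piMl//; last by rewrite -l2C (RtoC_le _ 1).
  by apply: sumr_ge0 => i _; apply: sumr_ge0.
rewrite /RtoC raddf_sum; apply: ler_sum => i _; rewrite raddf_sum.
by apply: ler_sum => j _; rewrite mxE; exact: (HB (i, j)).
Qed.

Lemma mnormR_le a p v : l2norm v <= 1 -> l2norm (v *m mev p a) <= mnormR a.
Proof. by move=> v1; apply: ub_le_sup; [exact: mset_ub | exists p, v]. Qed.

Lemma mnormR_ge0 a : 0 <= mnormR a.
Proof.
have [[t [p [v [v1 _]]]]|/set0P/negP/negPn/eqP E] := pselect (unit_ball_values a !=set0).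
  exact: le_trans (l2_ge0 _) (mnormR_le _ _ v1).
by rewrite /mnormR E sup0.
Qed.

Lemma mnorm_ge0 a : 0 <= mnorm a.
Proof. by rewrite RtoC_ge0 mnormR_ge0. Qed.

Lemma mnorm_ln a p v : l2c (v *m mev p a) <= l2c v * mnorm a.
Proof.
have [->|v0] := eqVneq v 0; first by rewrite mul0mx l2c0 mul0r.
have lv : l2c v != 0 by apply: contraNneq v0 => /l2c_eq0 ->.
have lv0 : 0 < l2c v by rewrite lt_def lv l2c_ge0.
rewrite mulrC -ler_pdivrMr//.
have nV : `|(l2c v)^-1| = (l2c v)^-1 by rewrite ger0_norm// invr_ge0 l2c_ge0.
have w1 : l2norm ((l2c v)^-1 *: v) <= 1.
  rewrite -(RtoC_le _ 1).
  rewrite l2C.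
  rewrite l2cZ.
  rewrite nV.
  by rewrite mulVf.
have := mnormR_le a p w1.
rewrite -RtoC_le.
rewrite l2C.
rewrite -(scalemxAl (l2c v)^-1 v).
rewrite l2cZ.
rewrite nV => h.
by rewrite [leLHS]mulrC.
Qed.

Lemma mnorm_ub a (c : C) : 0 <= c ->
  (forall p v, l2c (v *m mev p a) <= l2c v * c) -> mnorm a <= c.
Proof.
move=> c0 H; rewrite -(reK c0) RtoC_le.
have [ne|/set0P/negP/negPn/eqP E] := pselect (unit_ball_values a !=set0); last first.
  by rewrite /mnormR E sup0 -RtoC_ge0 reK.
apply: ge_sup => // _ [p [v [v1 ->]]].
rewrite -RtoC_le l2C reK//; apply: le_trans (H p v) _.
by rewrite ler_piMl// -l2C (RtoC_le _ 1).
Qed.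

Lemma l2cK (v : 'rV[C]_r) : l2c v ^+ 2 = dotmx v v :> C.
Proof. exact: sqrtCK. Qed.

Lemma le_of_sq (x y : C) : 0 <= x -> 0 <= y -> x ^+ 2 <= y ^+ 2 -> x <= y.
Proof. by move=> x0 y0; rewrite ler_sqr. Qed.

#[local] Opaque mnorm l2c.

Lemma mnormD a b : mnorm (a + b) <= mnorm a + mnorm b.
Proof.
apply: mnorm_ub => [|p v]; first by rewrite addr_ge0 ?mnorm_ge0.
rewrite mevD mulmxDr mulrDr; apply: le_trans (l2cD _ _) _.
by apply: lerD; exact: mnorm_ln.
Qed.

Lemma mnormZ_le (z : C) a : mnorm (z *: a) <= `|z| * mnorm a.
Proof.
apply: mnorm_ub => [|p v]; first by rewrite mulr_ge0 ?mnorm_ge0.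
by rewrite mevZ -scalemxAr l2cZ mulrCA ler_wpM2l// mnorm_ln.
Qed.

Lemma mnorm0 : mnorm 0 = 0.
Proof.
apply: le_anti; rewrite mnorm_ge0 andbT; apply: mnorm_ub => // p v.
by rewrite mev0 mulmx0 l2c0 mulr0.
Qed.

Lemma mnormZ (z : C) a : mnorm (z *: a) = `|z| * mnorm a.
Proof.
have [->|z0] := eqVneq z 0; first by rewrite scale0r normr0 mul0r mnorm0.
apply: le_anti; rewrite mnormZ_le /=.
rewrite -ler_pdivlMl ?normr_gt0// -normfV.
have := mnormZ_le z^-1 (z *: a).
rewrite (scalerA z^-1 z a).
rewrite (mulVf z0).
by rewrite (scale1r a).
Qed.

Lemma mnorm_eq0 a : mnorm a = 0 -> a = 0.
Proof.
move=> a0; apply: mevP => p; apply/row_matrixP => i.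
rewrite !rowE mev0 mulmx0; apply: l2c_eq0; apply: le_anti.
by rewrite l2c_ge0 andbT -(mulr0 (l2c (delta_mx 0 i))) -a0 mnorm_ln.
Qed.

Lemma mnormM a b : mnorm (a *m b : M) <= mnorm a * mnorm b.
Proof.
apply: mnorm_ub => [|p v]; first by rewrite mulr_ge0 ?mnorm_ge0.
rewrite mevM mulmxA mulrA; apply: le_trans (mnorm_ln _ _ _) _.
by rewrite ler_wpM2r ?mnorm_ge0// mnorm_ln.
Qed.

Lemma mstarK : involutive mstar.
Proof.
move=> a; apply: mevP => p; apply/matrixP => i j.
by rewrite !mev_star !mxE conjCK.
Qed.

Lemma mstar_le a : mnorm a ^+ 2 <= mnorm (a *m mstar a : M).
Proof.
set N := mnorm (_ *m _).
suff : mnorm a <= sqrtC N.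
  rewrite -(@ler_sqr C) ?nnegrE ?mnorm_ge0 ?sqrtC_ge0 ?mnorm_ge0// sqrtCK.
  by [].
apply: mnorm_ub => [|p v]; first by rewrite sqrtC_ge0 mnorm_ge0.
apply: le_of_sq; [exact: l2c_ge0|by rewrite mulr_ge0 ?l2c_ge0 ?sqrtC_ge0 ?mnorm_ge0|].
rewrite (exprMn 2 (l2c v) (sqrtC N)).
rewrite (sqrtCK N).
rewrite (l2cK (v *m mev p a)).
have Ege : 0 <= dotmx (v *m mev p a) (v *m mev p a) by exact: dnorm_ge0.
have E : dotmx (v *m mev p a) (v *m mev p a)
        = dotmx (v *m mev p (a *m mstar a : M)) v.
  rewrite !dotmxE mevM mev_star trmx_mul map_mxM !mulmxA.
  by rewrite map_trmx.
rewrite -(ger0_norm Ege) E.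
apply: le_trans (l2cCS _ _) _.
rewrite expr2 [leRHS]mulrAC; apply: ler_wpM2r; first exact: l2c_ge0.
exact: mnorm_ln.
Qed.

Lemma mnorm_star a : mnorm (mstar a) = mnorm a.
Proof.
have le b : mnorm b <= mnorm (mstar b).
  have [->|b0] := eqVneq (mnorm b) 0; first exact: mnorm_ge0.
  have := le_trans (mstar_le b) (mnormM _ _).
  by rewrite expr2 ler_pM2l// lt_def b0 mnorm_ge0.
apply: le_anti; apply/andP; split; last exact: le.
by have := le (mstar a); rewrite (mstarK a).
Qed.

Lemma mnorm_cstar a : mnorm (mstar a *m a : M) = mnorm a ^+ 2.
Proof.
apply: le_anti; apply/andP; split.
  by have := mnormM (mstar a) a; rewrite (mnorm_star a) -expr2.
by have := mstar_le (mstar a); rewrite (mstarK a) (mnorm_star a).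
Qed.

HB.instance Definition _ := Lmodule_isNormed.Build C M mnormD mnormZ mnorm_eq0.

End matCC.

Section matCC2.
#[local] Opaque cplx.
#[local] Opaque mnorm l2c.
Context {R : realType} {X : topologicalType} {cX : compact [set: X]} {r : nat}.
Local Notation C := (cplx R).
Local Notation CC := (Cfun R X * Cfun R X)%type.
Local Notation M := (@matCC R X cX r).
Implicit Types (a b : M) (p : bool * X) (h : CC).

Lemma CCevB p h h' : CCev p (h - h') = CCev p h - CCev p h'.
Proof. by rewrite CCevD CCevN. Qed.

Lemma entry_le p a i j : `|CCev p (a i j)| <= mnorm a.
Proof.
have := mnorm_ln a p (delta_mx 0 i); rewrite l2c_delta mul1r; apply: le_trans.
by have := l2c_entry (delta_mx 0 i *m mev p a) j; rewrite -rowE !mxE.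
Qed.

Lemma mnorm_entry a (c : C) : 0 <= c ->
  (forall p i j, `|CCev p (a i j)| <= c) -> mnorm a <= c *+ (r * r).
Proof.
move=> c0 H; apply: mnorm_ub => [|p v]; first by rewrite mulrn_wge0.
apply: le_trans (l2c_mul _ _) _; apply: ler_wpM2l; first exact: l2c_ge0.
apply: (@le_trans _ _ (\sum_(i < r) \sum_(j < r) c)).
  by apply: ler_sum => i _; apply: ler_sum => j _; rewrite mxE; exact: H.
by rewrite !sumr_const !card_ord mulrnA.
Qed.

Lemma matCC_complete (F : set_system M) : ProperFilter F -> cauchy F -> cvg F.
Proof.
move=> FF /cauchy_ballP Fc.
have Fc' (e : C) : 0 < e -> exists2 U, F U & forall a b, U a -> U b -> mnorm (a - b) < e.
  move=> e0; have [[U V] /= [FU FV] UV] := Fc e e0.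
  exists (U `&` V); first exact: filterI.
  move=> a b [Ua _] [_ Vb]; have /= := UV (a, b) (conj Ua Vb).
  by rewrite -ball_normE.
pose g p i j (a : M) := CCev p (a i j).
have gL p i j a b : `|g p i j a - g p i j b| <= mnorm (a - b).
  by have := entry_le p (a - b) i j; rewrite !mxE CCevB.
have /choice[L HL] : forall q : (bool * X) * ('I_r * 'I_r), exists l : C,
    g q.1 q.2.1 q.2.2 @ F --> l.
  move=> [p [i j]]; apply/cvg_ex => /=; apply: cplx_complete.
  apply/cauchy_ballP => e e0; rewrite near_map2.
  have [U FU HU] := Fc' e e0; exists (U, U) => //= -[a b] [/= Ua Ub].
  by rewrite -ball_normE /=; apply: le_lt_trans (gL _ _ _ _ _) (HU _ _ Ua Ub).
have unif (e : C) : 0 < e -> exists2 U, F U &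
    forall a, U a -> forall p i j, `|g p i j a - L (p, (i, j))| < e.
  move=> e0; have e20 : 0 < e / 2 by rewrite divr_gt0.
  have [U FU HU] := Fc' _ e20; exists U => // a Ua p i j.
  have /cvgrPdist_lt/(_ _ e20) h := HL (p, (i, j)).
  have [b [Ub /= hb]] : exists b, U b /\ `|L (p, (i, j)) - g p i j b| < e / 2.
    by have [b [? ?]] := filter_ex (filterI FU h); exists b.
  have -> : g p i j a - L (p, (i, j)) = (g p i j a - g p i j b) + (g p i j b - L (p, (i, j))).
    by rewrite addrA subrK.
  rewrite [ltRHS]splitr.
  apply: le_lt_trans (ler_normD _ _) _; apply: ltrD; last by rewrite distrC.
  by apply: le_lt_trans (gL _ _ _ _ _) (HU _ _ Ua Ub).
have Lcts c i j : continuous (fun x : X => L ((c, x), (i, j)) : C).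
  move=> x; apply/cvgrPdist_lt => e e0.
  have e30 : 0 < e / 3 by rewrite divr_gt0.
  have [U FU HU] := unif _ e30; have [a Ua] := filter_ex FU.
  have cts : continuous (fun x : X => g (c, x) i j a : C).
    by case: c => /=; rewrite /g /CCev /=; exact: Cfun_cts.
  have /cvgrPdist_lt/(_ _ e30) := cts x.
  apply: filterS => y hy.
  have -> : L (c, x, (i, j)) - L (c, y, (i, j)) =
      - (g (c, x) i j a - L (c, x, (i, j))) + (g (c, x) i j a - g (c, y) i j a)
      + (g (c, y) i j a - L (c, y, (i, j))).
    by rewrite opprB !addrA !subrK.
  have eE : e = e / 3 + e / 3 + e / 3.
    have e3 : e = e / 3 * 3 by rewrite divfK// pnatr_eq0.
    by rewrite {1}e3 mulr_natr -addrA.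
  rewrite [ltRHS]eE.
  apply: le_lt_trans (ler_normD _ _) _; apply: ltrD; last exact: HU.
  apply: le_lt_trans (ler_normD _ _) _; apply: ltrD => //.
  by rewrite normrN; exact: HU.
pose l : M := \matrix_(i, j)
  ((mkcts (Lcts true i j) : Cfun R X), (mkcts (Lcts false i j) : Cfun R X)).
apply/cvg_ex; exists l; apply/cvgrPdist_lt => e e0.
have N0 : 0 < (r * r).+1%:R :> C by rewrite ltr0n.
have e0' : 0 < e / (r * r).+1%:R by rewrite divr_gt0.
have [U FU HU] := unif _ e0'; apply: filterS FU => a Ua.
rewrite distrC; apply: (@le_lt_trans _ _ ((e / (r * r).+1%:R) *+ (r * r))).
  apply: mnorm_entry => [|p i j]; first exact: ltW.
  rewrite !mxE CCevB; apply: ltW; have := HU _ Ua p i j.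
  by case: p => -[].
rewrite -mulr_natr -mulrA -[ltRHS]mulr1 ltr_pM2l// mulrC ltr_pdivrMr// mul1r.
by rewrite ltr_nat.
Qed.

End matCC2.

HB.instance Definition _ (R : realType) (X : topologicalType)
  (cX : compact [set: X]) (r : nat) :=
  Uniform_isComplete.Build (@matCC R X cX r) (@matCC_complete R X cX r).

Section cstar.
#[local] Opaque cplx.
#[local] Opaque mnorm l2c.
Context {R : realType} {X : topologicalType} (cX : compact [set: X]) (r : nat).
Local Notation M := (@matCC R X cX r).
Definition mmul (a b : M) : M := a *m b.
Fact mmul1l : left_id (1%:M : M) mmul. Proof. exact: mul1mx. Qed.
Fact mmul1r : right_id (1%:M : M) mmul. Proof. exact: mulmx1. Qed.
Fact mmulZl (z : cplx R) a b : mmul (z *: a) b = z *: mmul a b.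
Proof. by apply: mevP => p; rewrite mevM !mevZ mevM scalemxAl. Qed.
Fact mmulZr (z : cplx R) a b : mmul a (z *: b) = z *: mmul a b.
Proof. by apply: mevP => p; rewrite mevM !mevZ mevM scalemxAr. Qed.
Fact mstarD : {morph @mstar R X cX r : a b / a + b}.
Proof.
by move=> a b; apply: mevP => p; rewrite mevD !mev_star mevD map_mxD linearD.
Qed.
Fact mstarZ (z : cplx R) (a : M) : mstar (z *: a) = z^* *: mstar a.
Proof.
by apply: mevP => p; rewrite mevZ !mev_star mevZ map_mxZ linearZ.
Qed.
Fact mstarM (a b : M) : mstar (mmul a b) = mmul (mstar b) (mstar a).
Proof.
by apply: mevP => p; rewrite mevM !mev_star mevM map_mxM trmx_mul.
Qed.
Definition matCC_cstar : cstarAlg R :=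
  @CStarAlg R M 1%:M mmul (@mstar R X cX r) (@mulmxA _ _ _ _ _) mmul1l mmul1r
  (@mulmxDl _ _ _ _) (@mulmxDr _ _ _ _) mmulZl mmulZr mstarK mstarD mstarZ mstarM
  mnormM mnorm_cstar.
End cstar.

Definition d_ n := (2 ^ n.+1 - 1)%N.
Definition l_ n := (2 ^ n.+1)%N.
Definition r_ n := (\prod_(1 <= k < n.+1) 2 ^ k.+1)%N.
Definition s_ n := (\prod_(1 <= k < n.+1) (2 ^ k.+1 - 1))%N.
Lemma rS n : r_ n.+1 = (l_ n.+1 * r_ n)%N.
Proof. by rewrite /r_ big_nat_recr//= mulnC. Qed.
Lemma sS n : s_ n.+1 = (d_ n.+1 * s_ n)%N.
Proof. by rewrite /s_ big_nat_recr//= mulnC. Qed.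

Section construction.
Context {R : realType}.

Definition S2 : set 'rV[R]_3 := [set v | \sum_i v 0 i ^+ 2 = 1].

Lemma S2_compact : compact S2.
Proof.
apply: bounded_closed_compact.
  exists 1; split => // M M1 v /= v1; rewrite [leLHS]/Num.norm/= mx_normrE.
  apply/bigmax_leP; split => [|[i j] _ /=]; first exact: le_trans (ltW M1).
  rewrite (ord1 i); apply: le_trans (ltW M1).
  rewrite -(@ler_sqr R) ?nnegrE// real_normK ?num_real// expr1n -v1.
  rewrite (bigD1 j)//= lerDl sumr_ge0// => k _; exact: sqr_ge0.
have -> : S2 = (fun v : 'rV[R]_3 => \sum_i v 0 i ^+ 2) @^-1` [set 1] by [].
apply: preimage_closed; last exact: closed_eq.
have add_cts : continuous (fun y : R * R => y.1 + y.2) by exact: add_continuous.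
have sq_cts (i : 'I_3) : continuous (fun v : 'rV[R]_3 => v 0 i ^+ 2).
  have c : continuous (fun v : 'rV[R]_3 => v 0 i) by exact: coord_continuous.
  by move=> v; exact: (cvgM (c v) (c v)).
have := @continuous_big R 'I_3 +%R 0 xpredT add_cts 'rV[R]_3
  (index_enum _) (fun i v => v 0 i ^+ 2).
by move=> H v _; apply: H => i _; exact: sq_cts.
Qed.

Lemma set_type_compact (T : topologicalType) (S : set T) :
  compact S -> compact [set: set_type S].
Proof.
move=> cS F FF _.
have FS : F (@set_val T S @^-1` S).
  suff -> : @set_val T S @^-1` S = setT by exact: filterT.
  by apply/seteqP; split => // y _; exact: set_valP.
have [x [Sx cx]] := cS (@set_val T S @ F) _ FS.
exists (SigSub (mem_set Sx)); split => // U V FU.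
move=> [/= _ [[W oW <-] Wx WV]].
have FU' : F (@set_val T S @^-1` (@set_val T S @` U)).
  by apply: (filterS (P := U)) => // z Uz; exists z.
have [_ [[z Uz <-] Wz]] :=
  cx (@set_val T S @` U) W FU' (open_nbhs_nbhs (conj oW Wx)).
by exists z; split => //; exact: WV.
Qed.

Definition X_ n := {ptws 'I_(s_ n) -> set_type S2}.

Lemma X_compact n : compact [set: X_ n].
Proof.
have := @tychonoff 'I_(s_ n) (fun=> set_type S2) (fun=> setT)
  (fun=> set_type_compact S2_compact).
by congr compact; apply/seteqP; split.
Qed.

(* (S^2)^(s (n + 1)) is identified with ((S^2)^(s n))^(d (n + 1)) by lexicographic
   ordering of the pairs (nu, i). *)
Definition Pindex n (nu : 'I_(d_ n.+1)) (i : 'I_(s_ n)) : 'I_(s_ n.+1) :=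
  cast_ord (esym (sS n)) (mxtens_index (nu, i)).

Definition P_ n (nu : 'I_(d_ n.+1)) (y : X_ n.+1) : X_ n := fun i => y (Pindex nu i).

Lemma P_continuous n (nu : 'I_(d_ n.+1)) : continuous (P_ nu).
Proof.
move=> y.
have FF : Filter (P_ nu @ nbhs y) by exact: fmap_filter.
apply/cvg_sup => i.
have h : continuous (fun y : X_ n.+1 => y (Pindex nu i)) by exact: proj_continuous.
exact: (continuous_comp_initial (w := fun f : 'I_(s_ n) -> set_type S2 => f i) h).
Qed.

(* The composites P^(n)_nu1 o ... o P^(m-1)_nu(m-n) : X_m -> X_n for m >= n. *)
Inductive iterated_projection n : forall m, (X_ m -> X_ n) -> Prop :=
| IterProj0 : iterated_projection id
| IterProjS m (p : X_ m -> X_ n) (nu : 'I_(d_ m.+1)) :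
    iterated_projection p -> iterated_projection (p \o P_ nu).

Definition dense_choice (x : forall m, X_ m) : Prop :=
  forall n, dense [set y : X_ n | exists m (p : X_ m -> X_ n),
    iterated_projection p /\ y = p (x m)].

Definition A_ n : cstarAlg R := matCC_cstar (@X_compact n) (r_ n).

Local Notation CC n := (Cfun R (X_ n) * Cfun R (X_ n))%type.

(* The identification of M_(l (n + 1)) (x) M_(r n) with M_(r (n + 1)) is the
   Kronecker one. *)
Definition r_unindex n (i : 'I_(r_ n.+1)) : 'I_(l_ n.+1) * 'I_(r_ n) :=
  mxtens_unindex (cast_ord (rS n) i).

Section maps.
Variable x : forall m, X_ m.
Arguments x m : clear implicits.

(* The index i ranges over 0, ..., d (n + 1); the last one gets the constant
   entry, and [insub] casts the others to the index type of the projections. *)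
Definition lambda n (fg : CC n) : 'M[CC n.+1]_(l_ n.+1) :=
  diag_mx (\row_i
    if insub (val i) is Some nu
    then (Cfuncomp fg.1 (@P_continuous n nu), Cfuncomp fg.2 (@P_continuous n nu))
    else (Cfuncst (fg.2 (x n)), Cfuncst (fg.1 (x n)))).

(* lambda_n (x) id, applied entrywise to a = sum_kl a_kl (x) e_kl. *)
Definition Lambda n (a : A_ n) : A_ n.+1 :=
  \matrix_(i, j) lambda (a (r_unindex i).2 (r_unindex j).2)
                        (r_unindex i).1 (r_unindex j).1.

Lemma lambdaD n (h k : CC n) : lambda (h + k) = lambda h + lambda k.
Proof.
apply/matrixP => i j; rewrite !mxE; case: eqP => _; last by rewrite !mulr0n addr0.
by rewrite !mulr1n; case: insubP => *; congr (_, _); exact: CfunP.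
Qed.
Lemma lambdaM n (h k : CC n) : lambda (h * k) = lambda h *m lambda k.
Proof.
rewrite mulmx_diag; congr diag_mx; apply/rowP => i; rewrite !mxE.
by case: insubP => *; congr (_, _); exact: CfunP.
Qed.
Lemma lambdaZ n (z : cplx R) (h : CC n) i j : lambda (z *: h) i j = z *: lambda h i j.
Proof.
rewrite !mxE; case: eqP => _; last by rewrite !mulr0n scaler0.
by rewrite !mulr1n; case: insubP => *; congr (_, _); exact: CfunP.
Qed.
Lemma lambda1 n : lambda (1 : CC n) = 1%:M.
Proof.
apply/matrixP => i j; rewrite !mxE; case: eqP => _; last by rewrite !mulr0n.
by rewrite !mulr1n; case: insubP => *; congr (_, _); exact: CfunP.
Qed.
Lemma lambda_conj n (h : CC n) i j : lambda (CCconj h) i j = CCconj (lambda h j i).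
Proof.
rewrite !mxE eq_sym; case: eqP => [->|_]; last first.
  by rewrite !mulr0n; congr (_, _); apply: CfunP => y; exact: (esym (conjC0 _)).
by rewrite !mulr1n; case: insubP => *; congr (_, _); exact: CfunP.
Qed.
Lemma lambda0 n : lambda (0 : CC n) = 0.
Proof.
have := lambdaD (0 : CC n) 0; rewrite addr0 => /esym/eqP.
by rewrite -subr_eq0 addrK => /eqP.
Qed.

Lemma LambdaE n (a : A_ n) i j : Lambda a i j =
  lambda (a (r_unindex i).2 (r_unindex j).2) (r_unindex i).1 (r_unindex j).1.
Proof. by rewrite mxE. Qed.

Lemma A_linE n (z : cplx R) (a b : A_ n) i j : (z *: a + b : A_ n) i j = z *: a i j + b i j.
Proof. by rewrite !mxE. Qed.
Lemma A_mulE n (a b : A_ n) i j : (a ** b : A_ n) i j = \sum_k a i k * b k j.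
Proof. by rewrite !mxE. Qed.
Lemma A_oneE n i j : (cs_one (A_ n)) i j = (i == j)%:R.
Proof. by rewrite !mxE. Qed.
Lemma A_starE n (a : A_ n) i j : (cs_star a) i j = CCconj (a j i).
Proof. by rewrite !mxE. Qed.

Lemma Lambda_starhom n : is_unital_starhom (@Lambda n).
Proof.
split.
- move=> z a b; apply/matrixP => i j.
  by rewrite A_linE !LambdaE A_linE lambdaD [LHS]mxE lambdaZ.
- move=> a b; apply/matrixP => i j.
  rewrite A_mulE LambdaE A_mulE.
  rewrite (big_morph (@lambda n) (@lambdaD n) (lambda0 n)) summxE.
  pose f (q : 'I_(l_ n.+1) * 'I_(r_ n)) := cast_ord (esym (rS n)) (mxtens_index q).
  have fK : cancel f (@r_unindex n).
    by move=> q; rewrite /r_unindex /f cast_ordKV mxtens_indexK.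
  have Kf : cancel (@r_unindex n) f.
    by move=> q; rewrite /r_unindex /f mxtens_unindexK cast_ordK.
  rewrite [RHS](reindex f) /=; last by exists (@r_unindex n) => q _; [exact: fK|exact: Kf].
  transitivity (\sum_k1 \sum_k2 Lambda a i (f (k1, k2)) * Lambda b (f (k1, k2)) j).
    2: by rewrite pair_bigA; apply: eq_bigr => -[].
  rewrite exchange_big; apply: eq_bigr => k _ /=.
  by rewrite lambdaM mxE; apply: eq_bigr => k' _; rewrite !LambdaE fK.
- apply/matrixP => i j; rewrite LambdaE !A_oneE.
  case: (eqVneq i j) => [->|ij]; first by rewrite eqxx lambda1 mxE eqxx.
  case: (eqVneq (r_unindex i).2 _) => [E|_]; last by rewrite lambda0 mxE.
  rewrite lambda1 mxE; case: eqP => // E1; case/negP: ij; apply/eqP.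
  apply: (@cast_ord_inj _ _ (rS n)); apply: (can_inj (@mxtens_unindexK _ _)).
  by apply/eqP; rewrite -pair_eqE /pair_eq /=; apply/andP; split; apply/eqP.
- move=> a; apply/matrixP => i j.
  by rewrite LambdaE !A_starE LambdaE lambda_conj.
Qed.

End maps.

Definition alpha_ n (t : 'Z_2) (a : A_ n) : A_ n :=
  if t == 0 then a else map_mx (fun h : CC n => (h.2, h.1)) a.

(* (f, g) (x) c *)
Definition elem_tensor n (fg : CC n) (c : 'M[cplx R]_(r_ n)) : A_ n :=
  \matrix_(i, j) (c i j *: fg).

Lemma alpha_elem n (f g : Cfun R (X_ n)) c : alpha_ 1 (elem_tensor (f, g) c) = elem_tensor (g, f) c.
Proof. by apply/matrixP => i j; rewrite !mxE. Qed.

Lemma Lambda_elem x n (fg : CC n) c i j :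
  Lambda x (elem_tensor fg c) i j =
  c (r_unindex i).2 (r_unindex j).2 *: lambda x fg (r_unindex i).1 (r_unindex j).1.
Proof. by rewrite LambdaE [X in lambda _ X]mxE lambdaZ. Qed.

Lemma alpha_action n : is_cstar_action (@alpha_ n).
Proof.
have sK (a : A_ n) : alpha_ 1 (alpha_ 1 a) = a.
  by apply/matrixP => i j; rewrite !mxE; case: (a i j).
have hom : is_unital_starhom (@alpha_ n 1).
  split.
  - by move=> z a b; apply/matrixP => i j; rewrite !mxE.
  - move=> a b; apply/matrixP => i j; rewrite !mxE.
    rewrite (big_morph (fun h : CC n => (h.2, h.1)) (id1 := 0) (op1 := +%R)) //.
    by apply: eq_bigr => k _; rewrite !mxE.
  - by apply/matrixP => i j; rewrite !mxE; case: (i == j).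
  - by move=> a; apply/matrixP => i j; rewrite !mxE.
have Z2 (t : 'Z_2) : t = 0 \/ t = 1.
  by case: t => -[|[|//]] lt2; [left|right]; exact: val_inj.
split => [g||g h].
- have [->|->] := Z2 g; last by split => //; exists (@alpha_ n 1).
  by split; [split | exists id].
- by [].
- by have [->|->] := Z2 g; have [->|->] := Z2 h; apply/funext => a //=; rewrite sK.
Qed.

End construction.
Arguments X_ R n : clear implicits.
Arguments A_ R n : clear implicits.

(* Main.v *)
(* In each A_n = M_r(C(X_n)) (+) M_r(C(X_n)) the units of the two summands are
   central, mutually orthogonal projections with sum 1 that the flip exchanges.
   Their images in the limit commute with the image of A_n and are therefore
   Rokhlin projections as soon as A_n approximates the given finite set.  Such
   an n exists because the images of the A_n are dense: their closure S is a
   C*-algebra, so the universal property gives A -> S, and by uniqueness the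
   composite A -> S -> A is the identity. *)
Require Import Defs.
From HB Require Import structures.
From mathcomp Require Import all_boot all_order all_algebra all_fingroup.
From mathcomp Require Import all_classical all_reals all_analysis.
Import Order.TTheory GRing.Theory Num.Theory.
Import numFieldNormedType.Exports.
Set Implicit Arguments.
Unset Strict Implicit.
Unset Printing Implicit Defensive.
Local Open Scope classical_set_scope.
Local Open Scope ring_scope.

(** * Norm estimates and continuity of the operations of a C*-algebra *)

Section cstar_theory.
Context {R : realType} {A : cstarAlg R}.
Implicit Types a b : A.
#[local] Opaque cplx.

(** The C*-identity and submultiplicativity bound the square of [|b|] by [|cs_star b| * |b|].
    Cancelling [|b|] gives one inequality, and applying it to [cs_star a] gives the other. *)
Lemma cs_normr_star a : `|cs_star a| = `|a|.
Proof.
have le b : `|b| <= `|cs_star b|.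
  have [->|b0] := eqVneq b 0; first by rewrite normr0.
  have := cs_normM (cs_star b) b.
  by rewrite cs_norm_star expr2 ler_pM2r// normr_gt0.
apply: le_anti; rewrite le andbT.
by have := le (cs_star a); rewrite cs_starK.
Qed.

(** For a projection the C*-identity reads [|a| = |a| ^+ 2], so the norm is 0 or 1. *)
Lemma projection_norm_le1 a : is_projection a -> `|a| <= 1.
Proof.
move=> [aS aM]; have := cs_norm_star a; rewrite aS aM => E.
have [a0|a0] := eqVneq `|a| 0; first by rewrite a0.
by rewrite -(ler_pM2r (_ : 0 < `|a|)) ?lt_def ?a0 ?normr_ge0// mul1r -expr2 -E.
Qed.

Lemma cs_mulNr a b : a ** (- b) = - (a ** b).
Proof. by rewrite -scaleN1r cs_mulZr scaleN1r. Qed.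
Lemma cs_mulNl a b : (- a) ** b = - (a ** b).
Proof. by rewrite -scaleN1r cs_mulZl scaleN1r. Qed.

Lemma lipschitz_cts (f : A -> A) (K : cplx R) : 0 <= K ->
  (forall a b, `|f a - f b| <= K * `|a - b|) -> continuous f.
Proof.
move=> K0 fK a; apply/cvgrPdist_lt => e e0.
(* [K] may be 0, so the radius is obtained by dividing by [K + 1]. *)
have K1 : 0 < K + 1 by rewrite ltr_wpDl.
have : \forall b \near a, `|a - b| < e / (K + 1).
  have /cvgrPdist_lt : id b @[b --> a] --> a by exact: cvg_id.
  by apply; rewrite divr_gt0.
apply: filterS => b; rewrite ltr_pdivlMr// mulrC => h.
apply: le_lt_trans h; apply: le_trans (fK a b) _.
by rewrite ler_wpM2r// lerDl.
Qed.

Lemma cs_mull_cts a : continuous (cs_mul a).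
Proof.
apply: (@lipschitz_cts _ `|a|) => // b c.
by rewrite -cs_mulNr -cs_mulDr cs_normM.
Qed.
Lemma cs_mulr_cts a : continuous (cs_mul^~ a).
Proof.
apply: (@lipschitz_cts _ `|a|) => // b c.
by rewrite -cs_mulNl -cs_mulDl mulrC cs_normM.
Qed.
Lemma cs_star_cts : continuous (@cs_star R A).
Proof.
apply: (@lipschitz_cts _ 1) => // b c.
(* Conjugation fixes -1, so the conjugate-linear star respects differences. *)
by rewrite -scaleN1r -(conjCN1 (cplx R)) -cs_starZ scaleN1r -cs_starD cs_normr_star mul1r.
Qed.

End cstar_theory.

(** * Closed unital star-subalgebras as C*-algebras in their own right *)

Record cstarSub (R : realType) (A : cstarAlg R) := CStarSub {
  sub_set : set A;
  sub_closed : closed sub_set;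
  sub_lin : forall (z : cplx R) a b, sub_set a -> sub_set b -> sub_set (z *: a + b);
  sub_one : sub_set (cs_one A);
  sub_mul : forall a b, sub_set a -> sub_set b -> sub_set (a ** b);
  sub_star : forall a, sub_set a -> sub_set (cs_star a) }.

Section subalg.
Context {R : realType} {A : cstarAlg R} (S : cstarSub A).
#[local] Opaque cplx.

Definition mem_sub : {pred A} := fun a => a \in sub_set S.

Record subalg := Subalg { subalg_val : A; subalg_valP : subalg_val \in mem_sub }.

HB.instance Definition _ := [isSub for subalg_val].
HB.instance Definition _ := [Choice of subalg by <:].

Lemma mem_subP a : a \in mem_sub <-> sub_set S a.
Proof. by split => [|Sa]; [exact: set_mem | exact: mem_set]. Qed.

Lemma subalgP (u : subalg) : sub_set S (val u).
Proof. exact/mem_subP/subalg_valP. Qed.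

Fact mem_sub_submod : GRing.submod_closed mem_sub.
Proof.
split => [|z a b]; rewrite !mem_subP; last exact: sub_lin.
(* Zero is obtained as the combination -1 + 1 of the unit with itself. *)
by have := sub_lin (-1) (sub_one S) (sub_one S); rewrite scaleN1r addNr.
Qed.
HB.instance Definition _ := GRing.isSubmodClosed.Build (cplx R) A mem_sub mem_sub_submod.
HB.instance Definition _ := [SubChoice_isSubLmodule of subalg by <:].

Definition subalg_norm (u : subalg) : cplx R := `|val u|.
Fact subalg_normD u v : subalg_norm (u + v) <= subalg_norm u + subalg_norm v.
Proof. by rewrite /subalg_norm raddfD ler_normD. Qed.
Fact subalg_normZ z u : subalg_norm (z *: u) = `|z| * subalg_norm u.
Proof. by rewrite /subalg_norm linearZ normrZ. Qed.
Fact subalg_norm_eq0 u : subalg_norm u = 0 -> u = 0.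
Proof. by move=> /normr0_eq0 u0; apply: val_inj; rewrite raddf0. Qed.
HB.instance Definition _ := Lmodule_isNormed.Build (cplx R) subalg
  subalg_normD subalg_normZ subalg_norm_eq0.

Lemma subalg_normE (u : subalg) : `|u| = `|val u|.
Proof. by []. Qed.

(** The inclusion is isometric, so the image of a Cauchy filter converges in [A]. Closedness keeps
    the limit in the subalgebra. *)
Fact subalg_complete (F : set_system subalg) : ProperFilter F -> cauchy F -> cvg F.
Proof.
move=> FF /cauchy_ballP Fc.
have : cvg (val @ F).
  apply: cauchy_cvg; apply/cauchy_ballP => e e0; rewrite near_map2.
  apply: filterS (Fc e e0) => -[a b] /=.
  by rewrite -!ball_normE /= subalg_normE raddfB.
move=> /cvg_ex[l vl].
have Sl : sub_set S l.
  apply: (closed_cvg _ (@sub_closed _ _ S) _ _ vl).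
  by apply: nearW => u; exact: subalgP.
apply/cvg_ex; exists (Subalg (proj2 (mem_subP l) Sl)).
apply/cvgrPdist_lt => e e0.
move/cvgrPdist_lt/(_ _ e0) : vl; apply: filterS => u.
by rewrite subalg_normE raddfB.
Qed.
HB.instance Definition _ := Uniform_isComplete.Build subalg subalg_complete.

Lemma mem_sub1 : cs_one A \in mem_sub.
Proof. exact/mem_subP/sub_one. Qed.
Lemma mem_subM (u v : subalg) : val u ** val v \in mem_sub.
Proof. by apply/mem_subP/sub_mul; exact: subalgP. Qed.
Lemma mem_sub_star (u : subalg) : cs_star (val u) \in mem_sub.
Proof. exact/mem_subP/sub_star/subalgP. Qed.

Definition subalg_one := Subalg mem_sub1.
Definition subalg_mul u v := Subalg (mem_subM u v).
Definition subalg_star u := Subalg (mem_sub_star u).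

Fact subalg_mulA : associative subalg_mul.
Proof. by move=> u v w; apply: val_inj; exact: cs_mulA. Qed.
Fact subalg_mul1l : left_id subalg_one subalg_mul.
Proof. by move=> u; apply: val_inj; exact: cs_mul1l. Qed.
Fact subalg_mul1r : right_id subalg_one subalg_mul.
Proof. by move=> u; apply: val_inj; exact: cs_mul1r. Qed.
Fact subalg_mulDl : left_distributive subalg_mul +%R.
Proof. by move=> u v w; apply: val_inj; exact: cs_mulDl. Qed.
Fact subalg_mulDr : right_distributive subalg_mul +%R.
Proof. by move=> u v w; apply: val_inj; exact: cs_mulDr. Qed.
Fact subalg_mulZl (z : cplx R) u v : subalg_mul (z *: u) v = z *: subalg_mul u v.
Proof. by apply: val_inj; exact: cs_mulZl. Qed.
Fact subalg_mulZr (z : cplx R) u v : subalg_mul u (z *: v) = z *: subalg_mul u v.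
Proof. by apply: val_inj; exact: cs_mulZr. Qed.
Fact subalg_starK : involutive subalg_star.
Proof. by move=> u; apply: val_inj; exact: cs_starK. Qed.
Fact subalg_starD : {morph subalg_star : u v / u + v}.
Proof. by move=> u v; apply: val_inj; exact: cs_starD. Qed.
Fact subalg_starZ (z : cplx R) u : subalg_star (z *: u) = z^* *: subalg_star u.
Proof. by apply: val_inj; exact: cs_starZ. Qed.
Fact subalg_starM u v : subalg_star (subalg_mul u v) = subalg_mul (subalg_star v) (subalg_star u).
Proof. by apply: val_inj; exact: cs_starM. Qed.
Fact subalg_normM u v : `|subalg_mul u v| <= `|u| * `|v|.
Proof. exact: cs_normM. Qed.
Fact subalg_norm_star u : `|subalg_mul (subalg_star u) u| = `|u| ^+ 2.
Proof. exact: cs_norm_star. Qed.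

Definition subalg_cstar : cstarAlg R := @CStarAlg R subalg subalg_one subalg_mul
  subalg_star subalg_mulA subalg_mul1l subalg_mul1r subalg_mulDl subalg_mulDr
  subalg_mulZl subalg_mulZr subalg_starK subalg_starD subalg_starZ subalg_starM
  subalg_normM subalg_norm_star.

Lemma subalg_val_inj : injective (val : subalg_cstar -> A).
Proof. exact: val_inj. Qed.

Lemma subalg_val_starhom : is_unital_starhom (val : subalg_cstar -> A).
Proof. by split. Qed.

End subalg.

(** * Unital star-homomorphisms *)

Section starhom.
Context {R : realType}.
Implicit Types A B D : cstarAlg R.

Lemma starhom_id A : is_unital_starhom (@id A).
Proof. by split. Qed.

Lemma starhom_comp A B D (f : A -> B) (g : B -> D) :
  is_unital_starhom f -> is_unital_starhom g -> is_unital_starhom (g \o f).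
Proof.
move=> [fl fM f1 fs] [gl gM g1 gs].
split=> [z a b|a b||a] /=.
- by rewrite fl; exact: gl.
- by rewrite fM gM.
- by rewrite f1 g1.
- by rewrite fs gs.
Qed.

Variables (A B : cstarAlg R) (f : A -> B).
Hypothesis fh : is_unital_starhom f.
Lemma starhomM a b : f (a ** b) = f a ** f b. Proof. by case: fh. Qed.
Lemma starhom1 : f (cs_one A) = cs_one B. Proof. by case: fh. Qed.
Lemma starhom_star a : f (cs_star a) = cs_star (f a). Proof. by case: fh. Qed.
Lemma starhomL (z : cplx R) a b : f (z *: a + b) = z *: f a + f b.
Proof. by case: fh => h _ _ _; exact: h. Qed.
Lemma starhomD a b : f (a + b) = f a + f b.
Proof. by have := starhomL 1 a b; rewrite !scale1r. Qed.
Lemma starhom0 : f 0 = 0.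
Proof. by have := starhomL (-1) 0 0; rewrite !scaleN1r !addNr. Qed.
Lemma starhom_projection a : is_projection a -> is_projection (f a).
Proof. by move=> [aS aM]; split; rewrite -?starhom_star -?starhomM ?aS ?aM. Qed.
End starhom.

(** The preimage of [closure W] is closed and contains [V], hence contains the closure of [V]. *)
Lemma closure_homo (T U : topologicalType) (f : T -> U) (V : set T) (W : set U) :
  continuous f -> V `<=` f @^-1` W -> closure V `<=` f @^-1` closure W.
Proof.
move=> cf VW; rewrite [X in X `<=` _]closureE.
apply: smallest_sub; last by move=> v /VW /(@subset_closure _ W).
by apply: preimage_closed; [|exact: closed_closure].
Qed.

(** * Direct limits: uniqueness of homomorphisms, density and approximation *)

Section limit.
Context {R : realType} {A : nat -> cstarAlg R} {L : forall n, A n -> A n.+1}.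
Context {B : cstarAlg R} {phi : forall n, A n -> B}.
Arguments phi {n}.

Definition limit_image : set B := [set b | exists n a, b = @phi n a].

Section cocone.
Hypothesis cphi : is_cocone L (@phi).

Lemma cocone_lift m n (a : A n) : (n <= m)%N -> exists b : A m, phi b = phi a.
Proof. by move=> nm; rewrite -(subnK nm); exists (connecting_map L (m - n) a); case: cphi. Qed.

Lemma limit_image_cover (b c : B) : limit_image b -> limit_image c ->
  exists n (b' c' : A n), b = phi b' /\ c = phi c'.
Proof.
move=> [n [b' ->]] [m [c' ->]].
have [b'' <-] := cocone_lift b' (leq_maxl n m).
have [c'' <-] := cocone_lift c' (leq_maxr n m).
by exists (maxn n m), b'', c''.
Qed.

Local Notation V := (closure limit_image).
(** Separate continuity suffices: one variable at a time is moved from the image to its closure.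
    This costs a second closure, which idempotence absorbs. *)
Lemma closure_limit_image2 (op : B -> B -> B) :
  (forall c, continuous (op c)) -> (forall c, continuous (op^~ c)) ->
  (forall n (a b : A n), limit_image (op (phi a) (phi b))) ->
  forall b c, V b -> V c -> V (op b c).
Proof.
move=> cl cr h b c Vb Vc.
suff : closure V (op b c) by rewrite -(proj1 (closure_id V)) //; exact: closed_closure.
move: Vb; apply: (closure_homo (f := op^~ c)) => // {}b Ib /=.
move: Vc; apply: (closure_homo (f := op b)) => // {}c Ic /=.
by have [n [b' [c' [-> ->]]]] := limit_image_cover Ib Ic.
Qed.

Lemma limit_sub : exists S : cstarSub B, sub_set S = closure limit_image.
Proof.
have ph n : is_unital_starhom (@phi n) by case: cphi.
unshelve eexists; [exists V | by []].
- exact: closed_closure.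
- move=> z; apply: closure_limit_image2 => [c|c|n a b].
  + by move=> b; apply: cvgD; [exact: cvg_cst | exact: cvg_id].
  + by move=> b; apply: cvgD; [apply: cvgZr; exact: cvg_id | exact: cvg_cst].
  + by exists n, (z *: a + b); rewrite starhomL.
- by apply: subset_closure; exists 0%N, (cs_one _); rewrite starhom1.
- apply: closure_limit_image2 => [c|c|n a b]; first exact: cs_mull_cts.
    exact: cs_mulr_cts.
  by exists n, (a ** b); rewrite starhomM.
- apply: (closure_homo (f := cs_star)); first exact: cs_star_cts.
  by move=> _ [n [a ->]]; exists n, (cs_star a); rewrite starhom_star.
Qed.
End cocone.

(** Both maps factor the cocone [f \o phi], and the factorization is unique. *)
Lemma direct_limit_hom_eq (D : cstarAlg R) (f g : B -> D) :
  is_direct_limit L (@phi) -> is_unital_starhom f -> is_unital_starhom g ->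
  (forall n (a : A n), f (phi a) = g (phi a)) -> f = g.
Proof.
move=> [[ph pc] H] fh gh fg.
have [h [_ hu]] := H D (fun n => f \o @phi n) (conj (fun n => starhom_comp (ph n) fh)
  (fun k n a => congr1 f (pc k n a))).
by rewrite -(hu f) // -(hu g) //; split=> // n a; rewrite /= fg.
Qed.

Lemma direct_limit_dense : is_direct_limit L (@phi) -> dense limit_image.
Proof.
move=> lim; have [[ph pc] H] := lim; have cphi : is_cocone L (@phi) by split.
have [S SE] := limit_sub cphi.
have VS n (a : A n) : phi a \in mem_sub S.
  by apply/mem_subP; rewrite SE; apply: (@subset_closure _ limit_image); exists n, a.
(* The maps [phi] with codomain restricted to [S]; injectivity of the inclusion transfers the cocone
   laws to them. *)
pose psi n a : subalg_cstar S := Subalg (VS n a).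
have [|h [[hh hp] _]] := H (subalg_cstar S) psi.
  split=> [n|k n a]; last by apply: (@subalg_val_inj _ _ S); exact: pc.
  split=> [z a b|a b||a]; apply: (@subalg_val_inj _ _ S) => /=.
  - exact: starhomL.
  - exact: starhomM.
  - exact: starhom1.
  - exact: starhom_star.
have E : val \o h = id.
  apply: (direct_limit_hom_eq lim); last by move=> n a /=; rewrite hp.
    exact: starhom_comp hh (subalg_val_starhom S).
  exact: starhom_id.
have cV b : closure limit_image b.
  by rewrite -[b]/(id b) -E; by rewrite -SE; exact: (subalgP (h b)).
move=> U [b Ub] oU; have [c [Ic Uc]] := cV b U (open_nbhs_nbhs (conj oU Ub)).
by exists c.
Qed.

(** Induction on [F]: density approximates the new element at some stage [m], and all approximants
    are then pushed forward to stage [maxn m n]. *)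
Lemma direct_limit_approx (F : set B) (e : cplx R) :
  is_direct_limit L (@phi) -> finite_set F -> 0 < e ->
  exists n, forall b, F b -> exists a : A n, `|b - phi a| < e.
Proof.
move=> lim /finite_seqP[s ->] e0; have [cphi _] := lim.
elim: s => [|b s [n hn]]; first by exists 0%N.
have [|c [/= hc [m [a ac]]]] := direct_limit_dense lim (O := ball b e) _ (ball_open b e).
  by exists b; exact: ballxx.
exists (maxn m n) => d; rewrite /= inE => /predU1P[->|ds].
  have [a' a'a] := cocone_lift cphi a (leq_maxl m n).
  by exists a'; move: hc; rewrite -ball_normE /= ac a'a.
have [a' ha'] := hn d ds.
by have [a'' a''a] := cocone_lift cphi a' (leq_maxr m n); exists a''; rewrite a''a.
Qed.

End limit.

(** * The flip and the units of the two summands *)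

Section flip.
Context {R : realType}.
Local Notation CC n := (Cfun R (X_ R n) * Cfun R (X_ R n))%type.

(** Exchanging f and g exchanges the two components of each diagonal entry of [lambda], the
    composites with projections as well as the constants at [x n]. *)
Lemma alpha_Lambda (x : forall m, X_ R m) n (a : A_ R n) :
  alpha_ 1 (Lambda x a) = Lambda x (alpha_ 1 a).
Proof.
apply/matrixP => i j; rewrite !mxE; case: eqP => _; last by rewrite !mulr0n.
by rewrite !mulr1n; case: insubP.
Qed.

(** The summands are labelled by the group, so that the flip acts on the labels by translation. *)
Definition summand_unit n (t : 'Z_2) : CC n := if t == 0 then (1, 0) else (0, 1).
Definition summand_proj n (t : 'Z_2) : A_ R n := (summand_unit n t)%:M.

Lemma Z2P (t : 'Z_2) : t = 0 \/ t = 1.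
Proof. by case: t => -[|[|//]] lt2; [left|right]; exact: val_inj. Qed.

Lemma summand_unitM n t u : summand_unit n t * summand_unit n u =
  if t == u then summand_unit n t else 0.
Proof.
by have [->|->] := Z2P t; have [->|->] := Z2P u; congr (_, _); rewrite /= ?mulr0 ?mulr1.
Qed.

Lemma summand_projM n t u : summand_proj n t ** summand_proj n u =
  if t == u then summand_proj n t else 0.
Proof.
rewrite [LHS](_ : _ = (summand_unit n t)%:M *m (summand_unit n u)%:M) //.
by rewrite -scalar_mxM summand_unitM; case: eqP => // _; rewrite raddf0.
Qed.

Lemma summand_proj_projection n t : is_projection (summand_proj n t).
Proof.
split; last by rewrite summand_projM eqxx.
apply/matrixP => i j; rewrite !mxE eq_sym; case: eqP => _.
  rewrite !mulr1n.
  have [->|->] := Z2P t; congr (_, _); apply: CfunP => y;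
    by [exact: conjC1 | exact: conjC0].
by rewrite !mulr0n; congr (_, _); apply: CfunP => y; exact: conjC0.
Qed.

Lemma summand_proj_central n t (a : A_ R n) : summand_proj n t ** a = a ** summand_proj n t.
Proof. exact: (esym (scalar_mxC _ a)). Qed.

Lemma summand_proj_sum n : \sum_(t : 'Z_2) summand_proj n t = cs_one (A_ R n).
Proof.
rewrite big_ord_recl big_ord1.
rewrite [LHS](_ : _ = (summand_unit n 0)%:M + (summand_unit n 1)%:M) //.
rewrite -raddfD; congr (_%:M).
by congr (_, _); rewrite /= ?addr0 ?add0r.
Qed.

Lemma alpha_summand_proj n t u :
  alpha_ t (summand_proj n u) = summand_proj n (t * u)%g.
Proof.
have swap w : alpha_ 1 (summand_proj n w) = summand_proj n (1 + w).
  apply/matrixP => i j; rewrite !mxE; case: eqP => _; last by rewrite !mulr0n.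
  by rewrite !mulr1n; have [->|->] := Z2P w.
(* The group law of ['Z_2] is addition, so [swap] is the case [t = 1]. *)
by have [->|->] := Z2P t; [have [->|->] := Z2P u | exact: swap].
Qed.

End flip.

(** * The limit action and its Rokhlin projections *)

Theorem lemma6p4 (R : realType) (x : forall m : nat, X_ R m)
    (x_dense : dense_choice x) :
  (forall n : nat,
     @alpha_ R n.+1 1 \o @Lambda R x n = @Lambda R x n \o @alpha_ R n 1) /\
  forall (A : cstarAlg R) (Linf : forall n : nat, A_ R n -> A),
    is_direct_limit (@Lambda R x) Linf ->
    exists alpha : 'Z_2 -> A -> A,
      [/\ is_cstar_action alpha,
          forall (t : 'Z_2) (n : nat),
            alpha t \o Linf n = Linf n \o @alpha_ R n t,
          forall beta : 'Z_2 -> A -> A,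
            is_cstar_action beta ->
            (forall (t : 'Z_2) (n : nat),
               beta t \o Linf n = Linf n \o @alpha_ R n t) ->
            beta = alpha
        & rokhlin alpha].
Proof.
split=> [n|A Linf lim]; first by apply/funext => a; exact: alpha_Lambda.
have [[Lh Lc] H] := lim.
have alphah n t : is_unital_starhom (@alpha_ R n t).
  by have [/(_ t)[]] := @alpha_action R n.
have alphaK n (a : A_ R n) : alpha_ 1 (alpha_ 1 a) = a.
  by have [_ _ /(_ 1 1)/(congr1 (@^~ a))] := @alpha_action R n.
(* The flips commute with the connecting maps, so following them by [Linf] gives a second cocone;
   its mediating map [s] is the flip on the limit. *)
have [|s [[sh sL] _]] := H A (fun n => Linf n \o alpha_ 1).
  split=> [n|k n a]; first exact: starhom_comp.
  rewrite /= -[RHS](Lc k); congr (Linf _ _).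
  by elim: k => //= k <-; rewrite alpha_Lambda.
have sK b : s (s b) = b.
  suff /(congr1 (@^~ b)) : s \o s = id by [].
  apply: (direct_limit_hom_eq lim) => [||n a]; [exact: starhom_comp|exact: starhom_id|].
  by rewrite /= !sL /= alphaK.
pose alpha (t : 'Z_2) : A -> A := if t == 0 then id else s.
have alphaL t n : alpha t \o Linf n = Linf n \o alpha_ t.
  by apply/funext => a; have [->|->] := Z2P t => //=; exact: sL.
have acta : is_cstar_action alpha.
  split=> [t||t u].
  - have [->|->] := Z2P t; split; [exact: starhom_id|by exists id|exact: sh|by exists s].
  - by [].
  - by have [->|->] := Z2P t; have [->|->] := Z2P u; apply/funext => a //=; rewrite /alpha /= sK.
exists alpha; split=> //.
  (* Uniqueness: [beta t] and [alpha t] agree on the image of every stage. *)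
  move=> beta [bh b1 _] bL; apply/funext => t.
  apply: (direct_limit_hom_eq lim) => [||n a].
  - by case: (bh t).
  - by case: acta => /(_ t)[].
  - by rewrite -[LHS]/((beta t \o Linf n) a) -[RHS]/((alpha t \o Linf n) a) bL alphaL.
move=> F eps finF eps0.
(* Half of [eps] for each of the two terms of the commutator below. *)
have e2 : 0 < RtoC eps / 2 by rewrite divr_gt0 // RtoC_gt0.
have [n hn] := direct_limit_approx lim finF e2.
pose e t := Linf n (summand_proj n t).
have pe t : is_projection (e t).
  exact (starhom_projection (Lh n) (@summand_proj_projection R n t)).
exists e; split=> [//|t u tu|t u|t b Fb|].
- by rewrite -(starhomM (Lh n)) summand_projM (negPf tu) (starhom0 (Lh n)).
(* The projections are permuted exactly, so the difference is 0. *)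
- rewrite -[alpha t _]/((alpha t \o Linf n) _) alphaL /= alpha_summand_proj.
  by rewrite subrr normr0 RtoC_gt0.
- have [a ha] := hn b Fb.
  (* [e t] commutes with [Linf n a], so [b] may be replaced by the small error [b - Linf n a] in the
     commutator. *)
  have -> : e t ** b - b ** e t = e t ** (b - Linf n a) - (b - Linf n a) ** e t.
    rewrite cs_mulDr cs_mulDl cs_mulNr cs_mulNl -!(starhomM (Lh n)).
    by rewrite summand_proj_central opprD opprK addrACA addNr addr0.
  apply: le_lt_trans (ler_normB _ _) _; rewrite [ltRHS]splitr.
  apply: ltrD; apply: le_lt_trans (cs_normM _ _) _; apply: le_lt_trans ha.
    by rewrite ler_piMl// projection_norm_le1.
  by rewrite ler_piMr// projection_norm_le1.
- rewrite -(starhom1 (Lh n)) -summand_proj_sum.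
  by rewrite (big_morph (Linf n) (starhomD (Lh n)) (starhom0 (Lh n))).
Qed.
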